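(* Let $n \ge 2$ and let $Y$ be a multisubset of $\mathbb{R}$ of cardinality $N_n$ (counted with multiplicity), where $N_n = \sum_{k=0}^{n-2} \frac{(n-2)!}{(n-2-k)!} = 1 + (n-2) + (n-2)(n-3) + \dots + (n-2)!$. There exist a weighted complete graph $G$ with $[n]=\{1,\dots,n\}$ as set of vertices and two distinct vertices $i,j \in [n]$ such that $Y = \mathcal{D}_{i,j}(G)$ (equality of multisets) if and only if, for some distinct $i,j\in[n]$, the elements of $Y$ (counted with multiplicity) can be indexed bijectively by the finite sequences $(i,i_1,\dots,i_r,j)$ of elements of $[n]$ from $i$ to $j$ without repetitions ($r \ge 0$), the element with index $(i,i_1,\dots,i_r,j)$ being denoted $y_{i,i_1,\dots,i_r,j}$, in such a way that: (a) for any $r>2$ and any pairwise distinct $i_1,\dots,i_r \in [n]\setminus\{i,j\}$, $$ y_{i,i_1,\dots,i_r,j} = \frac{1}{2}\left( y_{i,i_1,i_r,j} - y_{i,i_r,i_1,j} + \sum_{s=1}^{r-1}\left( y_{i,i_s,i_{s+1},j} + y_{i,i_{s+1},i_s,j}\right)\right) - \sum_{s=2}^{r-1} y_{i,i_s,j};$$ (b) for any pairwise distinct $l,o,m \in [n]\setminus\{i,j\}$, $$ y_{i,m,l,j} + y_{i,o,m,j} + y_{i,l,o,j} = y_{i,l,m,j} + y_{i,m,o,j} + y_{i,o,l,j}.$$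
   Context: A weighted complete graph with vertex set $[n]=\{1,\dots,n\}$ is the complete simple graph on $[n]$ in which every edge $\{l,m\}$ is endowed with an arbitrary real number, its weight (not necessarily positive). A simple path between distinct vertices $i$ and $j$ is a path with ends $i$ and $j$ whose vertices are all distinct; it is denoted by the sequence $(i,i_1,\dots,i_r,j)$ of its vertices, $r\ge 0$ (paths are unoriented, so a sequence and its reverse denote the same path). The weight $w_G(p)$ of a path $p$ is the sum of the weights of its edges. $\mathcal{D}_{i,j}(G)$ is the multiset $\{ w_G(p) : p \text{ a simple path between } i \text{ and } j\}$, with one entry for each simple path. $N_n$ is the number of simple paths between two distinct vertices of the complete graph on $[n]$. A multisubset of $\mathbb{R}$ is a multiset of real numbers. *)

(* Defs.v *)
From mathcomp Require Import all_boot all_order all_algebra.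
From mathcomp Require Import finmap multiset reals.

Set Implicit Arguments.
Unset Strict Implicit.
Unset Printing Implicit Defensive.

Import Order.TTheory GRing.Theory Num.Theory.

Local Open Scope ring_scope.

(* The vertex set [n] = {1, ..., n} is represented by 'I_n. *)

Definition edge (n : nat) := {e : {set 'I_n} | #|e| == 2%N}.

Definition weighted_complete_graph (R : realType) (n : nat) := edge n -> R.

(* For i != j, the sequences i, i_1, ..., i_r, j (r >= 0) without repetitions,
   each listed once. A simple path between i and j, being unoriented, is
   represented by its unique enumeration that starts at i and ends at j.
   Absence of repetitions forces r <= n, so a bounded sequence of interior
   vertices loses nothing. *)
Definition simple_paths (n : nat) (i j : 'I_n) : seq (seq 'I_n) :=
  [seq i :: rcons (val s) j |
     s : n.-bseq 'I_n in [pred s | uniq (i :: rcons (val s) j)]].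

Definition path_edges (n : nat) (p : seq 'I_n) : seq {set 'I_n} :=
  [seq [set lm.1; lm.2] | lm <- zip p (behead p)].

(* Each edge counts once, which is the right multiplicity as p is simple. *)
Definition path_weight (R : realType) (n : nat)
    (G : weighted_complete_graph R n) (p : seq 'I_n) : R :=
  \sum_(e : edge n | val e \in path_edges p) G e.

(* The multiset of the values of y, with one entry for each simple path. *)
Definition path_values (R : realType) (n : nat) (i j : 'I_n)
    (y : seq 'I_n -> R) : {mset R}%mset :=
  seq_mset [seq y p | p <- simple_paths i j].

Definition Dmset (R : realType) (n : nat) (i j : 'I_n)
    (G : weighted_complete_graph R n) : {mset R}%mset :=
  path_values i j (path_weight G).

Definition num_simple_paths (n : nat) : nat :=
  (\sum_(0 <= k < n.-1) (n - 2)`! %/ (n - 2 - k)`!)%N.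

(* Main.v *)
(** Let [w l m] be the weight of the edge [{l, m}]. For weights of paths, the
    combination [y_{i,l,m,j} - y_{i,m,l,j}] is [d l - d m] with
    [d l = w i l - w l j]: this is a coboundary, which gives (b), and (a) is a
    telescoping identity. Conversely, (b) is the cocycle condition that makes
    [y_{i,l,m,j} - y_{i,m,l,j}] of the form [d l - d m]; solving
    [w i l + w l j = y_{i,l,j}] and [w i l - w l j = d l] gives the edges at [i]
    and [j], and [y_{i,l,m,j}] then gives the edge [{l, m}]. The weights of the
    longer paths are right because both sides satisfy (a). *)

Require Import Defs.
From mathcomp Require Import all_boot all_order all_algebra.
From mathcomp Require Import finmap multiset reals.
From mathcomp Require Import ring lra zify.

Set Implicit Arguments.
Unset Strict Implicit.
Unset Printing Implicit Defensive.

Import Order.TTheory GRing.Theory Num.Theory.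

Local Open Scope ring_scope.

(** Unlike [path_weight], which sums over a set of edges, this unfolds along the sequence; by
    [path_weightE] the two agree in the absence of repetitions. *)
Definition seq_weight (T : Type) (V : nmodType) (w : T -> T -> V) (p : seq T) : V :=
  \sum_(lm <- zip p (behead p)) w lm.1 lm.2.

(* Equal to [0] when [l = m], as then [[set l; m]] is not an edge. *)
Definition edge_weight (R : realType) (n : nat) (G : weighted_complete_graph R n)
    (l m : 'I_n) : R :=
  \sum_(e : edge n | val e == [set l; m]) G e.

(** Puts the interior of a path in the form used in (a), where indices start at 1; hence [k.-1]. *)
Lemma map_nth_iota (T : Type) (x0 : T) (p : seq T) :
  p = [seq nth x0 p k.-1 | k <- iota 1 (size p)].
Proof.
apply: (@eq_from_nth _ x0) => [|k k_lt]; first by rewrite size_map size_iota.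
by rewrite (nth_map 0%N) ?size_iota // nth_iota.
Qed.

Section SeqWeight.
Variables (T : Type) (V : nmodType) (w : T -> T -> V).

Lemma seq_weight1 a : seq_weight w [:: a] = 0.
Proof. by rewrite /seq_weight big_nil. Qed.

Lemma seq_weight_cons a b p :
  seq_weight w [:: a, b & p] = w a b + seq_weight w (b :: p).
Proof. by rewrite /seq_weight /= big_cons. Qed.

Lemma seq_weight_iota (x : nat -> T) j m k :
  seq_weight w (rcons [seq x s | s <- iota m k.+1] j) =
  \sum_(m <= s < m + k) w (x s) (x s.+1) + w (x (m + k)%N) j.
Proof.
elim: k m => [|k IH] m.
  by rewrite addn0 big_geq //= seq_weight_cons seq_weight1 addrC.
have -> : rcons [seq x s | s <- iota m k.+2] j
    = [:: x m, x m.+1 & rcons [seq x s | s <- iota m.+2 k] j] by [].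
rewrite seq_weight_cons (IH m.+1) addnS -addSn addrA.
by rewrite [in RHS]big_ltn // addSn ltnS leq_addr.
Qed.

End SeqWeight.

(** By symmetry of [w] the edge [{x 1, x r}] cancels in the difference, and the first sum counts
    each edge [{x s, x s.+1}] twice. What remains involves only edges at [i] and [j]. *)
Lemma seq_weight_long (F : numFieldType) (T : Type) (w : T -> T -> F)
    (wC : commutative w) (i j : T) (r : nat) (x : nat -> T) : (1 < r)%N ->
  seq_weight w (i :: rcons [seq x s | s <- iota 1 r] j) =
  2^-1 * (seq_weight w [:: i; x 1%N; x r; j] - seq_weight w [:: i; x r; x 1%N; j]
          + \sum_(1 <= s < r) (seq_weight w [:: i; x s; x s.+1; j]
                               + seq_weight w [:: i; x s.+1; x s; j]))
  - \sum_(2 <= s < r) seq_weight w [:: i; x s; j].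
Proof.
case: r => [|[|q]] // _.
have -> : i :: rcons [seq x s | s <- iota 1 q.+2] j
    = [:: i, x 1%N & rcons [seq x s | s <- iota 2 q.+1] j] by [].
rewrite seq_weight_cons -[x 1%N :: _]/(rcons [seq x s | s <- iota 1 q.+2] j).
rewrite seq_weight_iota.
pose t s := w i (x s) + w (x s) j.
pose C := \sum_(1 <= s < q.+2) w (x s) (x s.+1).
have -> : \sum_(1 <= s < q.+2) (seq_weight w [:: i; x s; x s.+1; j]
                               + seq_weight w [:: i; x s.+1; x s; j])
   = \sum_(1 <= s < q.+2) t s + \sum_(1 <= s < q.+2) t s.+1 + (C + C).
  rewrite -!big_split; apply: eq_bigr => s _ /=.
  rewrite !seq_weight_cons !seq_weight1 (wC (x s.+1) (x s)) /t; ring.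
have -> : \sum_(2 <= s < q.+2) seq_weight w [:: i; x s; j] = \sum_(2 <= s < q.+2) t s.
  by apply: eq_bigr => s _; rewrite !seq_weight_cons !seq_weight1 addr0.
have -> : \sum_(1 <= s < q.+2) t s.+1 = \sum_(2 <= s < q.+3) t s.
  by rewrite [RHS]big_add1.
(* The two sums of [t] share the range [2 <= s < q.+2], which the subtracted sum cancels. The
   leftover [t 1] and [t q.+2], added to the difference, give twice the first and last edges. *)
rewrite [\sum_(1 <= s < q.+2) t s]big_ltn // [\sum_(2 <= s < q.+3) t s]big_nat_recr //=.
rewrite !seq_weight_cons !seq_weight1 (wC (x q.+2) (x 1%N)) add1n -/C /t.
by field.
Qed.

Section PathWeight.
Variables (R : realType) (n : nat).
Implicit Types (G : weighted_complete_graph R n) (i j l m : 'I_n).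

Lemma edge_weightC G : commutative (edge_weight G).
Proof. by move=> l m; rewrite /edge_weight setUC. Qed.

Lemma path_edges_sub (p : seq 'I_n) A : A \in path_edges p -> {subset A <= p}.
Proof.
elim: p => [|a [|b p] IH] //; rewrite /path_edges /= inE.
case/orP=> [/eqP -> v|/IH A_bp v /A_bp]; last by rewrite [in X in _ -> X]inE orbC => ->.
by rewrite !inE => /pred2P[] ->; rewrite eqxx ?orbT.
Qed.

(** The head [a] does not occur in the tail, so the first edge [{a, b}] does not recur: summing over
    edges counts each consecutive pair once. *)
Lemma path_weightE G p : uniq p -> path_weight G p = seq_weight (edge_weight G) p.
Proof.
elim: p => [_|a [_ _|b p IH /andP[a_bp uniq_bp]]].
- by rewrite /seq_weight big_nil /path_weight big_pred0.
- by rewrite seq_weight1 /path_weight big_pred0.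
rewrite seq_weight_cons -IH //.
have ab_bp : [set a; b] \notin path_edges (b :: p).
  by apply: contra a_bp => /path_edges_sub; apply; rewrite set21.
rewrite /path_weight /edge_weight (bigID (fun e : edge n => val e == [set a; b])) /=.
congr (_ + _); apply: eq_bigl => e;
  rewrite -[path_edges _]/([set a; b] :: path_edges (b :: p)) inE.
  by rewrite andbC; case: eqP.
by rewrite andbC; case: eqP => //= ->; rewrite (negbTE ab_bp).
Qed.

Lemma edge_weight_surj (f : 'I_n -> 'I_n -> R) :
  (forall l m, l != m -> f l m = f m l) ->
  exists G, forall l m, l != m -> edge_weight G l m = f l m.
Proof.
move=> fC.
(* The order in which [enum] lists the two ends is harmless since [f] is symmetric; an edge has
   cardinality 2, so the default [0] is never reached. *)
exists (fun e : edge n => if enum (val e) is [:: a; b] then f a b else 0) => l m lm.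
have card_lm : #|[set l; m]| == 2%N by rewrite cards2 lm.
rewrite /edge_weight (big_pred1 (Sub [set l; m] card_lm)) => [|e]; last by [].
rewrite SubK.
have := mem_enum [set l; m]; have := enum_uniq [set l; m].
have : size (enum [set l; m]) = 2%N by rewrite -cardE; apply/eqP.
case: (enum _) => [|a [|b []]] //= _.
rewrite inE andbT => ab mem_lm.
have := mem_lm a; have := mem_lm b; rewrite !inE !eqxx orbT /=.
move=> /esym/pred2P[] eb /esym/pred2P[] ea; move: ab; rewrite ea eb ?eqxx // => _.
by rewrite fC // eq_sym.
Qed.

(** Every path occurring in (a) is simple, so that weights can be computed by [path_weightE]. *)
Lemma uniq_subpaths i j (r : nat) (x : nat -> 'I_n) :
  i <> j -> uniq [seq x s | s <- iota 1 r] ->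
  (forall s : nat, (1 <= s <= r)%N -> x s <> i /\ x s <> j) ->
  [/\ uniq (i :: rcons [seq x s | s <- iota 1 r] j),
      forall s, (1 <= s <= r)%N -> uniq [:: i; x s; j] &
      forall s t, (1 <= s <= r)%N -> (1 <= t <= r)%N -> s != t ->
        uniq [:: i; x s; x t; j]].
Proof.
move=> /eqP ij uniq_x x_ij.
set X := [seq _ | _ <- _] in uniq_x *.
have xE s : (1 <= s <= r)%N -> x s = nth i X s.-1.
  case: s => // s /= s_lt; rewrite (nth_map 0%N) ?size_iota //.
  by rewrite nth_iota.
have x_inj s t : (1 <= s <= r)%N -> (1 <= t <= r)%N -> s != t -> x s != x t.
  move=> hs ht st; rewrite !xE // nth_uniq // ?size_map ?size_iota; lia.
have xiN s : (1 <= s <= r)%N -> i != x s.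
  by case/x_ij => /eqP xi _; rewrite eq_sym.
have xjN s : (1 <= s <= r)%N -> x s != j by case/x_ij => _ /eqP.
split=> [|s hs|s t hs ht st]; last 2 first.
- by rewrite /= !inE negb_or ij xiN ?xjN.
- by rewrite /= !inE !negb_or ij !xiN ?xjN ?x_inj.
rewrite /= mem_rcons inE negb_or ij rcons_uniq uniq_x andbT /=.
apply/andP; split; apply/mapP => -[s]; rewrite mem_iota => hs e.
  by have /xiN/eqP := hs.
by have /xjN/eqP := hs; apply.
Qed.

Lemma path_weight_long G i j (r : nat) (x : nat -> 'I_n) :
  i <> j -> (1 < r)%N -> uniq [seq x s | s <- iota 1 r] ->
  (forall s : nat, (1 <= s <= r)%N -> x s <> i /\ x s <> j) ->
  path_weight G (i :: rcons [seq x s | s <- iota 1 r] j) =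
  2^-1 * (path_weight G [:: i; x 1%N; x r; j] - path_weight G [:: i; x r; x 1%N; j]
          + \sum_(1 <= s < r) (path_weight G [:: i; x s; x s.+1; j]
                               + path_weight G [:: i; x s.+1; x s; j]))
  - \sum_(2 <= s < r) path_weight G [:: i; x s; j].
Proof.
move=> ij r_gt1 uniq_x /(uniq_subpaths ij uniq_x)[uniq_p uniq1 uniq2].
rewrite !path_weightE // ?uniq2 //; [|lia..].
rewrite (seq_weight_long (edge_weightC G)) //.
congr (_ * (_ + _) - _); apply: eq_big_nat => s hs.
  by rewrite !path_weightE // uniq2 //; lia.
by rewrite path_weightE // uniq1 //; lia.
Qed.

(** Each side contains exactly once every edge joining [i] or [j] to [l], [o], [m], and every edge
    among [l], [o], [m]. *)
Lemma path_weight_cocycle G i j l o m : uniq [:: l; o; m; i; j] ->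
  path_weight G [:: i; m; l; j] + path_weight G [:: i; o; m; j]
    + path_weight G [:: i; l; o; j] =
  path_weight G [:: i; l; m; j] + path_weight G [:: i; m; o; j]
    + path_weight G [:: i; o; l; j].
Proof.
move=> uniq_all.
have uniqE a b : uniq [:: i; a; b; j] ->
    path_weight G [:: i; a; b; j] =
    edge_weight G i a + edge_weight G a b + edge_weight G b j.
  by move=> h; rewrite path_weightE // !seq_weight_cons seq_weight1 addr0 !addrA.
move: uniq_all; rewrite /= !inE !negb_or => /and5P[].
move=> /and4P[lo lm li lj] /and3P[om oi oj] /andP[mi mj] ij _.
rewrite !uniqE ?/= ?inE ?negb_or ?(eq_sym i l) ?(eq_sym i o) ?(eq_sym i m)
  ?li ?oi ?mi ?lj ?oj ?mj ?lo ?lm ?om ?ij ?(eq_sym o l) ?(eq_sym m l)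
  ?(eq_sym m o) ?lo ?lm ?om //.
by rewrite (edge_weightC G m l) (edge_weightC G m o) (edge_weightC G o l); ring.
Qed.

(** Only paths with at most two interior vertices are prescribed, since (a) determines the
    others. *)
Lemma path_weight_surj i j (y0 : R) (t : 'I_n -> R) (z : 'I_n -> 'I_n -> R) :
  i != j ->
  (forall l o m, uniq [:: l; o; m; i; j] ->
     z m l + z o m + z l o = z l m + z m o + z o l) ->
  exists G, [/\ path_weight G [:: i; j] = y0,
    forall l, uniq [:: i; l; j] -> path_weight G [:: i; l; j] = t l &
    forall l m, uniq [:: i; l; m; j] -> path_weight G [:: i; l; m; j] = z l m].
Proof.
move=> ij z_cocycle.
have [d dE] : exists d, forall l m, uniq [:: l; m; i; j] -> d l - d m = z l m - z m l.
  (* A base vertex [k] normalises the potential by [d k = 0]. If there is none, no admissible [l],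
     [m] exist and [d = 0] will do. *)
  case: (pickP [pred k | (k != i) && (k != j)]) => [k /andP[ki kj]|none]; last first.
    exists (fun=> 0) => l m; rewrite /= !inE !negb_or => /andP[/and3P[_ li lj] _].
    by have /negP[] := none l; apply/andP.
  exists (fun l => z l k - z k l) => l m uniq_lm.
  have [->|lk] := eqVneq l k; first by ring.
  have [->|mk] := eqVneq m k; first by ring.
  have /z_cocycle : uniq [:: l; k; m; i; j].
    move: uniq_lm; rewrite /= !inE !negb_or lk (eq_sym k m) mk ki kj /=.
    by case/andP=> /and3P[-> -> ->] ->.
  by lra.
(* [a l] and [b l] are the future weights of [{i, l}] and [{l, j}], solving [a l + b l = t l] and
   [a l - b l = d l]. *)
pose a l := 2^-1 * (t l + d l); pose b l := 2^-1 * (t l - d l).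
pose w l m :=
  if l == i then if m == j then y0 else a m else
  if l == j then if m == i then y0 else b m else
  if m == i then a l else if m == j then b l else z l m - a l - b m.
have [|G GE] := @edge_weight_surj w.
  (* Symmetry of [w] is in question only for [l], [m] outside [{i, j}], where it amounts to
     [d l - d m = z l m - z m l]. *)
  move=> l m lm; rewrite /w.
  have [li|li] := eqVneq l i; have [mi|mi] := eqVneq m i;
  have [lj|lj] := eqVneq l j; have [mj|mj] := eqVneq m j => //;
  subst; rewrite ?eqxx // in ij lm *.
  have := dE l m; rewrite /= !inE !negb_or lm li lj mi mj ij => /(_ isT).
  by rewrite /a /b; lra.
have ijF : (j == i) = false by rewrite eq_sym; apply: negbTE.
exists G; split=> [|l uniq_p|l m uniq_p].
- rewrite path_weightE; last by rewrite /= inE ij.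
  by rewrite seq_weight_cons seq_weight1 GE // /w !eqxx addr0.
- move: (uniq_p); rewrite path_weightE // !seq_weight_cons seq_weight1 /= !inE.
  rewrite negb_or => /and3P[/andP[il _] lj _].
  rewrite !GE // /w !eqxx (negbTE lj) (eq_sym l i) (negbTE il) ijF /a /b; lra.
move: (uniq_p); rewrite path_weightE // !seq_weight_cons seq_weight1 /= !inE.
rewrite !negb_or => /and4P[/and3P[il im _] /andP[lm lj] mj _].
rewrite !GE // /w !eqxx (negbTE lj) (negbTE mj) (eq_sym l i) (eq_sym m i).
by rewrite (negbTE il) (negbTE im) ijF /a /b; lra.
Qed.

End PathWeight.

Theorem theorem8 (R : realType) (n : nat) (hn : (2 <= n)%N)
    (Y : {mset R}%mset) (hY : size Y = num_simple_paths n) :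
  (exists (G : weighted_complete_graph R n) (i j : 'I_n),
      i <> j /\ Y = Dmset i j G) <->
  (exists i j : 'I_n, i <> j /\
    exists y : seq 'I_n -> R,
      [/\ Y = path_values i j y,
          (forall (r : nat) (x : nat -> 'I_n), (2 < r)%N ->
             uniq [seq x s | s <- iota 1 r] ->
             (forall s : nat, (1 <= s <= r)%N -> x s <> i /\ x s <> j) ->
             y (i :: rcons [seq x s | s <- iota 1 r] j) =
               2^-1 * (y [:: i; x 1%N; x r; j] - y [:: i; x r; x 1%N; j]
                       + \sum_(1 <= s < r) (y [:: i; x s; x s.+1; j]
                                            + y [:: i; x s.+1; x s; j]))
               - \sum_(2 <= s < r) y [:: i; x s; j])
        & (forall l o m : 'I_n, uniq [:: l; o; m; i; j] ->
             y [:: i; m; l; j] + y [:: i; o; m; j] + y [:: i; l; o; j] =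
             y [:: i; l; m; j] + y [:: i; m; o; j] + y [:: i; o; l; j])]).
Proof.
split=> [[G [i [j [ij ->]]]]|[i [j [ij [y [-> yA yB]]]]]].
  exists i, j; split=> //; exists (path_weight G); split=> // [r x r_gt2 uniq_x x_ij|l o m].
    by apply: path_weight_long => //; apply: ltnW.
  exact: path_weight_cocycle.
have ij' : i != j by apply/eqP.
have [G [G0 G1 G2]] := path_weight_surj (y [:: i; j]) (fun l => y [:: i; l; j]) ij' yB.
exists G, i, j; split=> //; congr seq_mset; apply/eq_in_map => p.
case/imageP=> s; rewrite inE; case: s => s /= _ uniq_p ->.
(* Up to two interior vertices, [G] was built to match [y]; from three on, (a) applies. *)
case: s uniq_p => [|a [|b [|c s]]] uniq_p; rewrite ?G0 ?G1 ?G2 //.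
move: uniq_p (isT : (2 < size [:: a, b, c & s])%N).
set q := [:: a, b, c & s].
rewrite [q](map_nth_iota i); move: (size q) (fun k => nth i q k.-1) => r x {q}.
rewrite size_map size_iota => uniq_p r_gt2.
have x_ij k : (1 <= k <= r)%N -> x k <> i /\ x k <> j.
  move=> hk; have xk : x k \in [seq x k | k <- iota 1 r].
    by apply: map_f; rewrite mem_iota.
  move: uniq_p; rewrite mem_rcons inE negb_or rcons_uniq.
  by case/andP=> /andP[_ ip] /andP[jp _]; split=> e;
    move: xk; rewrite e (negbTE ip, negbTE jp).
have uniq_x : uniq [seq x k | k <- iota 1 r].
  by move: uniq_p; rewrite /= rcons_uniq => /and3P[].
have [_ uniq1 uniq2] := uniq_subpaths ij uniq_x x_ij.
rewrite yA // path_weight_long //; last exact: ltnW.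
rewrite !G2 ?uniq2 //; [|lia..].
congr (_ * (_ + _) - _); apply: eq_big_nat => k hk.
  by rewrite !G2 // uniq2 //; lia.
by rewrite G1 // uniq1 //; lia.
Qed.
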